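(* Let $R$ be a simply laced extended affine root system of rank $>1$. Then $\mathcal M_r=\mathcal M_{rm}$, where $\mathcal M_{rm}=\mathcal M_r\cap\mathcal M_m$.
   Context: All vector spaces are finite-dimensional and real. Let $\mathcal V$ be a vector space with a positive semidefinite symmetric bilinear form $(\cdot,\cdot)$ with radical $\mathcal V^0$. For $R\subseteq\mathcal V$ put $R^0=R\cap\mathcal V^0$, $R^\times=R\setminus R^0$. For $(\alpha,\alpha)\ne0$ put $\alpha^\vee=2\alpha/(\alpha,\alpha)$, $w_\alpha(\beta)=\beta-(\beta,\alpha^\vee)\alpha$. $\langle A\rangle$ is the additive subgroup generated by $A$. $P\subseteq\mathcal V\setminus\mathcal V^0$ is connected if it is not a disjoint union of nonempty $P_1,P_2$ with $(P_1,P_2)=\{0\}$. $R$ is an extended affine root system if: $\langle R\rangle$ is a full lattice in $\mathcal V$; $(\beta,\alpha^\vee)\in\mathbb Z$ for $\alpha,\beta\in R^\times$; $w_\alpha(\beta)\in R$ for $\alpha\in R^\times,\beta\in R$; $R^0=\mathcal V^0\cap(R^\times-R^\times)$; $\alpha\in R^\times\Rightarrow2\alpha\notin R$; $R^\times$ is connected. In particular $R^\times\ne\emptyset$. The image $\bar R$ of $R$ in $\mathcal V/\mathcal V^0$ is an irreducible finite root system (containing $0$); type and rank of $R$ are those of $\bar R$. Simply laced of rank $>1$ means type $A_\ell$ ($\ell\ge2$), $D_\ell$ ($\ell\ge4$) or $E_{6,7,8}$. Weyl group: there is a finite root system $\dot R\subseteq R$ mapping isometrically onto $\bar R$ with $\mathcal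 V=\dot{\mathcal V}\oplus\mathcal V^0$, $\dot{\mathcal V}=\mathrm{span}\,\dot R$. Put $\tilde{\mathcal V}=\dot{\mathcal V}\oplus\mathcal V^0\oplus(\mathcal V^0)^*$ and extend the form by $(\dot{\mathcal V},(\mathcal V^0)^* )=((\mathcal V^0)^*,(\mathcal V^0)^* )=\{0\}$, $(\sigma,\lambda)=\lambda(\sigma)$. $\mathcal W\le GL(\tilde{\mathcal V})$ is generated by $w_\alpha:\beta\mapsto\beta-(\beta,\alpha^\vee)\alpha$, $\alpha\in R^\times$; $\mathcal W_P$ is the subgroup generated by $w_\alpha$, $\alpha\in P$. $\mathcal M_r$ is the class of reflectable bases: $P\subseteq R^\times$ with $\mathcal W_PP=R^\times$ such that no proper subset $P'$ of $P$ satisfies $\mathcal W_{P'}P'=R^\times$. $\mathcal M_m$ is the class of $P\subseteq R^\times$ minimal under inclusion with respect to $\mathcal W_P=\mathcal W$. *)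

(* Defs.v *)
From HB Require Import structures.
From mathcomp Require Import all_boot all_order all_algebra.
From mathcomp Require Import all_classical reals.
From mathcomp Require Import ring.

Set Implicit Arguments.
Unset Strict Implicit.
Unset Printing Implicit Defensive.

Import Order.TTheory GRing.Theory Num.Theory.

Local Open Scope classical_set_scope.
Local Open Scope ring_scope.

Section Lattices.
Variables (K : realType) (V : vectType K).

Definition additive_subgroup (G : set V) : Prop :=
  G 0 /\ forall x y, G x -> G y -> G (x - y).

Definition generated (A : set V) : set V := smallest additive_subgroup A.

Definition full_lattice (G : set V) : Prop :=
  exists2 X : (\dim {:V}).-tuple V, basis_of {:V} X &
    G = [set \sum_(i < \dim {:V}) X`_i *~ c i | c in [set: 'I_(\dim {:V}) -> int]].

End Lattices.

Section GeneralLinear.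
Variables (K : realType) (U : vectType K).

(* The first condition says that G consists of invertible endomorphisms, on
   which f^-1 is the two-sided inverse. *)
Definition GL_subgroup (G : set 'End(U)) : Prop :=
  [/\ forall f, G f -> lker f == 0%VS,
      G \1%VF,
      forall f g, G f -> G g -> G (f \o g)%VF &
      forall f, G f -> G (f^-1)%VF].

End GeneralLinear.

Section Reflections.
Variables (K : realType) (U : vectType K) (form : {symmetric U}).

Definition coroot (a : U) : U := (2 / form a a) *: a.

Definition reflection (a b : U) : U := b - form b (coroot a) *: a.

Lemma reflection_is_linear a : linear (reflection a).
Proof.
move=> k x y; rewrite /reflection linearPl /= scalerDl -scalerA.
by rewrite scalerBr opprD addrACA.
Qed.

HB.instance Definition _ a :=
  GRing.isLinear.Build K U U _ (reflection a) (reflection_is_linear a).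

Lemma reflectionK a : involutive (reflection a).
Proof.
move=> x; rewrite {1}/reflection.
have [a0|a0] := eqVneq (form a a) 0.
  have c0 : coroot a = 0 by rewrite /coroot a0 invr0 mulr0 scale0r.
  by rewrite /reflection c0 !linear0r /= !scale0r !subr0.
have ca : form a (coroot a) = 2 by rewrite /coroot linearZr /= mulfVK.
rewrite {2}/reflection linearBl linearZl_LR /= ca /reflection.
rewrite -addrA -opprD -scalerDl.
by rewrite [X in X *: a](_ : _ = 0) ?scale0r ?subr0 //; ring.
Qed.

Lemma lker_reflection a : lker (linfun (reflection a)) == 0%VS.
Proof.
apply/lker0P => x y; rewrite !lfunE /= => e.
by rewrite -[x](reflectionK a) e reflectionK.
Qed.

(* Phi lists the roots, 0 included. *)
Definition finite_root_system (Phi : seq U) : Prop :=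
  [/\ 0 \in Phi,
      forall x, x \in <<Phi>>%VS -> x != 0 -> 0 < form x x,
      forall a b, a \in Phi -> a != 0 -> b \in Phi ->
        form b (coroot a) \is a Num.int &
      forall a b, a \in Phi -> a != 0 -> b \in Phi -> reflection a b \in Phi].

(* Base of a root system Phi (0 included) spanning U. *)
Definition root_base (Phi : set U) (l : nat) (X : l.-tuple U) : Prop :=
  [/\ basis_of {:U} X,
      forall i : 'I_l, Phi X`_i &
      forall a, Phi a -> exists c : 'I_l -> nat,
        a = \sum_(i < l) X`_i *+ c i \/ a = - \sum_(i < l) X`_i *+ c i].

End Reflections.

Inductive simply_laced_type := TypeA of nat | TypeD of nat | TypeE of nat.

Definition type_rank (t : simply_laced_type) : nat :=
  match t with TypeA l => l | TypeD l => l | TypeE l => l end.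

Definition type_rank_gt1 (t : simply_laced_type) : bool :=
  match t with
  | TypeA l => (2 <= l)%N
  | TypeD l => (4 <= l)%N
  | TypeE l => l \in [:: 6; 7; 8]%N
  end.

(* Edges {i, j}, i < j, of a path 0 - 1 - ... - l-2 with one more node l-1
   attached to the node k of that path. *)
Definition branch_edge (l k i j : nat) : bool :=
  ((j == i.+1) && (j < l.-1)%N) || ((i == k) && (j == l.-1)).

(* The last node l-1 is the one off the longest path: for E_l it is the node
   usually numbered 2, for D_l one of the two ends of the fork. *)
Definition dynkin_edge (t : simply_laced_type) (i j : nat) : bool :=
  match t with
  | TypeA l => j == i.+1
  | TypeD l => branch_edge l (l - 3) i j
  | TypeE l => branch_edge l 2 i j
  end.

Definition cartan (t : simply_laced_type) (i j : nat) : int :=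
  if i == j then 2
  else if dynkin_edge t i j || dynkin_edge t j i then -1
  else 0.

Section ExtendedAffine.
Variables (K : realType) (V : vectType K) (form : {symmetric V}).

Definition radical : {vspace V} := orthov form fullv.

Lemma radicalP x : reflect (forall y, form x y = 0) (x \in radical).
Proof.
by apply: (iffP mem_orthovP) => [h y|h y _]; [apply: h; rewrite memvf|apply: h].
Qed.

Definition isotropic (R : set V) : set V := R `&` [set` radical].

Definition nonisotropic (R : set V) : set V := R `\` isotropic R.

Definition form_connected (P : set V) : Prop :=
  ~ exists P1 P2 : set V,
      [/\ P1 !=set0, P2 !=set0, P1 `|` P2 = P, P1 `&` P2 = set0 &
          forall x y, P1 x -> P2 y -> form x y = 0].

Record extended_affine_root_system (R : set V) : Prop := {
  ears_lattice : full_lattice (generated R);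
  ears_int : forall a b, nonisotropic R a -> nonisotropic R b ->
    form b (coroot form a) \is a Num.int;
  ears_reflection : forall a b, nonisotropic R a -> R b ->
    R (reflection form a b);
  ears_isotropic : isotropic R =
    [set` radical] `&` [set a - b | a in nonisotropic R & b in nonisotropic R];
  ears_reduced : forall a, nonisotropic R a -> ~ R (2 *: a);
  ears_nonempty : nonisotropic R !=set0;
  ears_connected : form_connected (nonisotropic R)
}.

(* V / V^0 is realised on a complement of the radical, the quotient map being
   the projection along the radical: see lker_quot_map and limg_quot_map. *)
Local Notation quot_space := (subvs_of (radical^C)%VS).

Definition quot_map : 'Hom(V, quot_space) :=
  (linfun (vsproj (radical^C)%VS) \o daddv_pi (radical^C)%VS radical)%VF.

Lemma capv_complC : (radical^C :&: radical = 0)%VS.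
Proof. by rewrite capvC capv_compl. Qed.

Lemma val_quot_map x : vsval (quot_map x) = daddv_pi (radical^C)%VS radical x.
Proof. by rewrite comp_lfunE lfunE /= vsprojK // memv_pi. Qed.

Lemma quot_dec x :
  daddv_pi (radical^C)%VS radical x + daddv_pi radical (radical^C)%VS x = x.
Proof. by rewrite daddv_pi_add ?capv_complC // addvC addv_complf memvf. Qed.

Lemma lker_quot_map : lker quot_map = radical.
Proof.
apply/vspaceP => x; rewrite memv_ker -(inj_eq val_inj) /= val_quot_map.
apply/eqP/idP => [h|xr].
  by rewrite -[x]quot_dec h add0r memv_pi.
have := quot_dec x; rewrite (@daddv_pi_id _ _ radical) ?capv_compl //.
by move/(canRL (addrK _)); rewrite subrr.
Qed.

Lemma limg_quot_map : limg quot_map = fullv.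
Proof.
apply/vspaceP => y; rewrite memvf; apply/memv_imgP; exists (vsval y).
  exact: memvf.
by apply: val_inj; rewrite /= val_quot_map daddv_pi_id ?capv_complC ?subvsP.
Qed.

Definition quot_form (x y : quot_space) : K := form (vsval x) (vsval y).

Lemma quot_form_bilinear : bilinear_for
  (GRing.Scale.Law.clone _ _ ( *%R ) _)
  (GRing.Scale.Law.clone _ _ (idfun \; *%R) _)
  (quot_form : quot_space -> quot_space -> K).
Proof.
by split=> z k x y; rewrite /quot_form /= ?linearPl ?linearPr.
Qed.

HB.instance Definition _ :=
  bilinear_isBilinear.Build K quot_space quot_space K
    (GRing.Scale.Law.clone _ _ ( *%R ) _)
    (GRing.Scale.Law.clone _ _ (idfun \; *%R) _)
    quot_form quot_form_bilinear.

Lemma quot_form_sym (x y : quot_space) :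
  quot_form x y = (-1) ^+ false * idfun (quot_form y x).
Proof. by rewrite /quot_form [LHS]hermC. Qed.

HB.instance Definition _ :=
  isHermitianSesquilinear.Build K quot_space false idfun quot_form
    quot_form_sym.

Lemma quot_form_map x y : quot_form (quot_map x) (quot_map y) = form x y.
Proof.
rewrite /quot_form !val_quot_map -[in RHS](quot_dec x) -[in RHS](quot_dec y).
have radl u v : u \in radical -> form u v = 0 by move/radicalP.
have radr u v : v \in radical -> form u v = 0.
  by move=> vr; rewrite hermC radl // mulr0.
set p := daddv_pi _ _ x; set q := daddv_pi _ _ y.
set p' := daddv_pi _ _ x; set q' := daddv_pi _ _ y.
have p'r : p' \in radical by apply: memv_pi.
have q'r : q' \in radical by apply: memv_pi.
by rewrite linearDl /= (radl _ _ p'r) addr0 linearDr /= (radr _ _ q'r) addr0.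
Qed.

Definition quot_image (R : set V) : set quot_space := quot_map @` R.

Definition has_type (R : set V) (t : simply_laced_type) : Prop :=
  exists2 X : (type_rank t).-tuple quot_space,
    root_base (quot_image R) X &
    forall i j : 'I_(type_rank t),
      quot_form X`_i (coroot quot_form X`_j) = (cartan t i j)%:~R.

Definition simply_laced_rank_gt1 (R : set V) : Prop :=
  exists2 t, type_rank_gt1 t & has_type R t.

Record finite_lift (R : set V) (dotR : seq V) : Prop := {
  lift_root_system : finite_root_system form dotR;
  lift_sub : [set` dotR] `<=` R;
  lift_inj : {in dotR &, injective quot_map};
  lift_image : quot_map @` [set` dotR] = quot_image R;
  lift_isometry : {in dotR &, forall a b,
    quot_form (quot_map a) (quot_map b) = form a b};
  lift_full : (<<dotR>> + radical)%VS = fullv;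
  lift_direct : directv (<<dotR>> + radical)
}.

(* Since V is the direct sum of dotV and V^0, the space
   dotV (+) V^0 (+) (V^0)^* is V (+) (V^0)^*; dotV only enters through the
   extended form. *)
Definition ext_space := (V * 'Hom(subvs_of radical, K^o))%type.

HB.instance Definition _ := Vector.on ext_space.

Definition ext_inj (x : V) : ext_space := (x, 0).

End ExtendedAffine.

Section WeylGroup.
Variables (K : realType) (V : vectType K) (form : {symmetric V}).
Variable dotR : seq V.

Local Notation V0 := (radical form).

(* The component in V^0 of x : V along dotV. *)
Definition radical_part (x : V) : subvs_of V0 :=
  vsproj V0 (daddv_pi V0 <<dotR>>%VS x).

Definition ext_form (x y : ext_space form) : K :=
  form x.1 y.1 + y.2 (radical_part x.1) + x.2 (radical_part y.1).

Lemma radical_part_is_linear : linear radical_part.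
Proof. by move=> k x y; rewrite /radical_part !linearP. Qed.

HB.instance Definition _ :=
  GRing.isLinear.Build K V (subvs_of V0) _ radical_part radical_part_is_linear.

Lemma ext_form_sym (x y : ext_space form) :
  ext_form x y = (-1) ^+ false * idfun (ext_form y x).
Proof.
rewrite /ext_form expr0 mul1r /= [form x.1 _]hermC expr0 mul1r /=.
by rewrite addrAC.
Qed.

Lemma ext_form_bilinear : bilinear_for
  (GRing.Scale.Law.clone _ _ ( *%R ) _)
  (GRing.Scale.Law.clone _ _ (idfun \; *%R) _)
  (ext_form : ext_space form -> ext_space form -> K).
Proof.
have lin x k y z : ext_form x (k *: y + z) = k * ext_form x y + ext_form x z.
  rewrite /ext_form /= !linearP /= add_lfunE scale_lfunE /= /GRing.scale /=.
  ring.
split=> x k y z /=; last exact: lin.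
by rewrite ![ext_form _ x]ext_form_sym !expr0 !mul1r /= lin.
Qed.

HB.instance Definition _ :=
  bilinear_isBilinear.Build K (ext_space form) (ext_space form) K
    (GRing.Scale.Law.clone _ _ ( *%R ) _)
    (GRing.Scale.Law.clone _ _ (idfun \; *%R) _)
    ext_form ext_form_bilinear.

HB.instance Definition _ :=
  isHermitianSesquilinear.Build K (ext_space form) false idfun ext_form
    ext_form_sym.

Definition weyl_reflection (a : V) : 'End(ext_space form) :=
  linfun (reflection ext_form (ext_inj form a)).

Definition weyl (P : set V) : set 'End(ext_space form) :=
  smallest (@GL_subgroup K (ext_space form)) (weyl_reflection @` P).

Definition weyl_orbit (P : set V) : set (ext_space form) :=
  [set w (ext_inj form a) | w in weyl P & a in P].

Lemma weyl_GL_subgroup P : GL_subgroup (weyl P).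
Proof.
have GL_GL : GL_subgroup [set f : 'End(ext_space form) | lker f == 0%VS].
  split=> //=.
  - by apply/lker0P => x y; rewrite !id_lfunE.
  - move=> f g /lker0P fi /lker0P gi.
    by apply/lker0P => x y; rewrite !comp_lfunE => /fi /gi.
  - move=> f f0; apply/lker0P => x y h.
    by rewrite -(lker0_lfunVK f0 x) -(lker0_lfunVK f0 y) h.
split=> [f|G [[]//]|f g wf wg G GP|f wf G GP].
- move=> wf; apply: (wf [set f | lker f == 0%VS]); split; first exact: GL_GL.
  by move=> _ [a _ <-]; apply: lker_reflection.
- by case: (GP) => -[_ _ GM _] _; apply: GM; [apply: wf|apply: wg].
- by case: (GP) => -[_ _ _ GV] _; apply: GV; apply: wf.
Qed.

Variable R : set V.

(* W_P P = R^x, as subsets of the extended space. *)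
Definition reflectable (P : set V) : Prop :=
  weyl_orbit P = ext_inj form @` nonisotropic form R.

Definition reflectable_bases : set (set V) :=
  [set P | [/\ P `<=` nonisotropic form R, reflectable P &
               forall P', P' `<` P -> ~ reflectable P']].

(* The Weyl group W of R is weyl (nonisotropic form R). *)
Definition minimal_weyl_generators : set (set V) :=
  [set P | [/\ P `<=` nonisotropic form R,
               weyl P = weyl (nonisotropic form R) &
               forall P', P' `<` P -> weyl P' <> weyl (nonisotropic form R)]].

Definition minimal_reflectable_bases : set (set V) :=
  reflectable_bases `&` minimal_weyl_generators.

End WeylGroup.

(* Main.v *)
Require Import Defs.
From mathcomp Require Import all_boot all_order all_algebra.
From mathcomp Require Import all_classical reals.
From mathcomp Require Import ring zify.

Set Implicit Arguments.
Unset Strict Implicit.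
Unset Printing Implicit Defensive.

Import Order.TTheory GRing.Theory Num.Theory.

Local Open Scope classical_set_scope.
Local Open Scope ring_scope.

(** Write W for the Weyl group, R^x for the set of nonisotropic roots, and W_P
    for the group generated by the reflections in the members of P.

    If W_P P = R^x, then every root has the form w a with w in W_P and a in P,
    and its reflection is the conjugate w w_a w^-1, which lies in W_P; hence
    W_P = W ([reflectable_weyl]).  For the minimality of a reflectable base P
    as a set of generators, the point is that W is transitive on R^x
    ([weyl_transitive]).  A subset Q of P with W_Q = W is nonempty because W is
    not trivial, so W_Q Q = W Q = R^x and Q is reflectable
    ([weyl_reflectable]); by minimality of P, it is not a proper subset.

    Transitivity has two parts.  Modulo the radical a root is, up to sign, a
    combination of simple roots with natural coefficients.  As in the theory
    of finite root systems, reflections in lifts of simple roots lower the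
    height until the root is a multiple c X_i of a simple root; pairing it
    with a neighbour of X_i in the diagram gives -1/c, which has to be an
    integer, so c = 1 and the root is a lift of X_i
    ([simple_lift_combination]).  It remains to compare lifts of simple roots.
    Two roots that pair to -1 in both orders are conjugate
    ([reflection_adjacent]), so any lift of X_i is conjugate to any lift of a
    neighbour X_j.  The diagram is connected, and since the rank exceeds 1 each
    node has a neighbour, so two lifts of the same simple root, which may
    differ by any isotropic root, are conjugate to a common lift of a
    neighbouring one.  Thus all lifts are conjugate. *)

(** * Reflections and the positive semidefinite form *)

Section Form.
Variables (K : realType) (U : vectType K) (form : {symmetric U}).

Lemma formC x y : form x y = form y x.
Proof. by rewrite [LHS]hermC mul1r. Qed.

Lemma form_coroot x a : form x (coroot form a) = 2 / form a a * form x a.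
Proof. by rewrite /coroot linearZr. Qed.

Lemma form_coroot_self a : form a a != 0 -> form a (coroot form a) = 2.
Proof. by move=> a0; rewrite form_coroot mulfVK. Qed.

Lemma reflection_self a : form a a != 0 -> reflection form a a = - a.
Proof.
move=> a0; rewrite /reflection form_coroot_self // scaler_nat mulr2n.
by rewrite opprD addrA subrr sub0r.
Qed.

Lemma reflection_isometry a x y :
  form (reflection form a x) (reflection form a y) = form x y.
Proof.
have [a0|a0] := eqVneq (form a a) 0.
  have r z : reflection form a z = z.
    by rewrite /reflection form_coroot a0 invr0 mulr0 mul0r scale0r subr0.
  by rewrite !r.
rewrite /reflection !form_coroot linearBl /= !linearBr /= !linearZl_LR /=.
by rewrite !linearZr /= [form a y]formC; field.
Qed.

(** Two roots that pair to -1 in both orders span a root system of type A2,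
    where the product of the two reflections carries one to the other. *)
Lemma reflection_adjacent a b :
  form a (coroot form b) = -1 -> form b (coroot form a) = -1 ->
  reflection form a (reflection form b a) = b.
Proof.
move=> ab ba.
have a0 : form a a != 0.
  apply: contra_eqN ba => /eqP a0.
  by rewrite form_coroot a0 invr0 mulr0 mul0r eq_sym oppr_eq0 oner_eq0.
have -> : reflection form b a = a + b.
  by rewrite /reflection ab scaleN1r opprK.
rewrite linearD /= reflection_self // /reflection ba scaleN1r opprK.
by rewrite addrC addrK.
Qed.

(** An isotropic vector of a semidefinite form is in its radical: otherwise
    the form would be an affine function with nonzero slope, hence take
    negative values, along a line in its direction. *)
Lemma psd_isotropic a :
  (forall x, 0 <= form x x) -> form a a = 0 -> forall y, form a y = 0.
Proof.
move=> psd a0 y; apply/eqP/negPn/negP => ay.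
pose t := (form y y + 1) / (2 * form a y).
have := psd (y - t *: a).
rewrite linearBl /= !linearBr /= !linearZl_LR /= !linearZr /= a0 (formC y a).
have -> : form y y - t * form a y - (t * form a y - t * (t * 0)) = -1.
  by rewrite /t; field.
by rewrite ler0N1.
Qed.

End Form.

(** * Connectedness of the Dynkin diagrams *)

(** For the numbering used by the diagrams, every node but the first is joined
    to an earlier one, so the diagram is connected. *)
Lemma dynkin_edge_left t i : type_rank_gt1 t -> (0 < i < type_rank t)%N ->
  exists2 j, (j < i)%N & dynkin_edge t j i.
Proof.
case: t => l /= rk /andP[i0 il]; first by exists i.-1 => //; [|apply/eqP]; lia.
- have [ile|ilt] := eqVneq i l.-1.
    by exists (l - 3)%N; [lia|rewrite /branch_edge ile !eqxx orbT].
  by exists i.-1; [|rewrite /branch_edge]; lia.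
- have [ile|ilt] := eqVneq i l.-1.
    exists 2; last by rewrite /branch_edge ile !eqxx orbT.
    by move: rk; rewrite ile !inE => /or3P[] /eqP ->.
  by exists i.-1; [|rewrite /branch_edge]; lia.
Qed.

Lemma dynkin_edge01 t :
  type_rank_gt1 t -> (1 < type_rank t)%N /\ dynkin_edge t 0 1.
Proof.
case: t => l /= rk; first by [].
- by split; [lia|rewrite /branch_edge; lia].
- by move: rk; rewrite !inE => /or3P[] /eqP ->.
Qed.

Lemma cartan_edge t i j : (i < j)%N -> dynkin_edge t i j ->
  cartan t i j = -1 /\ cartan t j i = -1.
Proof.
by move=> ij e; rewrite /cartan (ltn_eqF ij) (gtn_eqF ij) e orbT.
Qed.

(** * The Weyl group *)

Section Weyl.
Variables (K : realType) (V : vectType K) (form : {symmetric V}).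
Variable dotR : seq V.

Local Notation iota := (ext_inj form).
Implicit Types (P : set V) (f g : 'End(ext_space form)).

Lemma ext_form_inj x y : ext_form dotR (iota x) (iota y) = form x y.
Proof. by rewrite /ext_form /= !zero_lfunE !addr0. Qed.

Lemma ext_inj_is_inj : injective iota.
Proof. by move=> x y []. Qed.

Lemma weyl_reflection_inj a x :
  weyl_reflection form dotR a (iota x) = iota (reflection form a x).
Proof.
rewrite lfunE /= /reflection !form_coroot /= ext_form_inj.
congr pair; first by rewrite /= ext_form_inj.
by rewrite /= scaler0 subrr.
Qed.

Lemma weyl_sub P (G : set 'End(ext_space form)) :
  GL_subgroup G -> (forall a, P a -> G (weyl_reflection form dotR a)) ->
  weyl dotR P `<=` G.
Proof. by move=> GG GP f; apply; split=> // _ [a Pa <-]; apply: GP. Qed.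

Lemma weyl_gen P a : P a -> weyl dotR P (weyl_reflection form dotR a).
Proof. by move=> Pa; apply: sub_gen_smallest; exists a. Qed.

Lemma weyl_lker0 P f : weyl dotR P f -> lker f == 0%VS.
Proof. by case: (weyl_GL_subgroup form dotR P) => h _ _ _ /h. Qed.

Lemma weyl_id P : weyl dotR P (\1%VF : 'End(ext_space form)).
Proof. by case: (weyl_GL_subgroup form dotR P). Qed.

Lemma weyl_comp P f g : weyl dotR P f -> weyl dotR P g ->
  weyl dotR P (f \o g : 'End(ext_space form))%VF.
Proof. by case: (weyl_GL_subgroup form dotR P) => _ _ h _; apply: h. Qed.

Lemma weyl_inv P f : weyl dotR P f ->
  weyl dotR P (f^-1 : 'End(ext_space form))%VF.
Proof. by case: (weyl_GL_subgroup form dotR P) => _ _ _ h; apply: h. Qed.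

(** The Weyl group lies in the group of bijective isometries of the extended
    form, as this group contains the reflections. *)
Lemma weyl_isometry P f x y :
  weyl dotR P f -> ext_form dotR (f x) (f y) = ext_form dotR x y.
Proof.
pose G := [set g : 'End(ext_space form) | lker g == 0%VS /\
  forall x y, ext_form dotR (g x) (g y) = ext_form dotR x y].
suff sub : weyl dotR P `<=` G by move=> /sub[_].
apply: weyl_sub => [|a _]; last first.
  by split=> [|u v]; [exact: lker_reflection|rewrite !lfunE reflection_isometry].
split=> [g [] //||g h [g0 gi] [h0 hi]|g [g0 gi]].
- by split=> [|u v]; [apply/lker0P => u v; rewrite !id_lfunE|rewrite !id_lfunE].
- split=> [|u v]; last by rewrite !comp_lfunE gi hi.
  apply/lker0P => u v; rewrite !comp_lfunE => e.
  by apply: (lker0P h0); apply: (lker0P g0).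
- split=> [|u v]; last by rewrite -gi !lker0_lfunVK.
  by apply/lker0P => u v e; rewrite -[u](lker0_lfunVK g0) e lker0_lfunVK.
Qed.

(** An isometry conjugates the reflection in a root to the reflection in its
    image, so a set that reaches every root generates every reflection. *)
Lemma weyl_reflection_conj P f a b :
  weyl dotR P f -> P a -> f (iota a) = iota b ->
  weyl dotR P (weyl_reflection form dotR b).
Proof.
move=> Wf Pa fab; have f0 := weyl_lker0 Wf.
suff -> : weyl_reflection form dotR b =
    (f \o (weyl_reflection form dotR a \o f^-1))%VF.
  by apply: weyl_comp => //; apply: weyl_comp; [exact: weyl_gen|exact: weyl_inv].
apply/lfunP => x; rewrite !comp_lfunE !lfunE /= /reflection !form_coroot -fab /=.
rewrite (weyl_isometry _ _ Wf) -[X in ext_form _ X (f _)](lker0_lfunVK f0).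
rewrite (weyl_isometry _ _ Wf).
by rewrite [RHS]linearB [X in _ = _ - X]linearZ /= lker0_lfunVK.
Qed.

Lemma weyl0 f : weyl dotR set0 f -> f = \1%VF :> 'End(ext_space form).
Proof.
apply: (@weyl_sub set0 [set \1%VF]) => //; split=> //=.
- by move=> _ ->; apply/lker0P => u v; rewrite !id_lfunE.
- by move=> _ _ -> ->; rewrite comp_lfun1l.
- move=> _ ->; apply/lfunP => u; rewrite !id_lfunE.
  rewrite -[LHS]id_lfunE lker0_lfunVK //.
  by apply/lker0P => v w; rewrite !id_lfunE.
Qed.

End Weyl.

(** * Transitivity on the roots *)

Section Orbits.
Variables (K : realType) (V : vectType K) (form : {symmetric V}).
Variables (dotR : seq V) (R : set V).

Local Notation iota := (ext_inj form).
Local Notation Rx := (nonisotropic form R).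

Definition weyl_conjugate a b :=
  exists2 w : 'End(ext_space form), weyl dotR Rx w & w (iota a) = iota b.

Lemma weyl_conjugate_refl a : weyl_conjugate a a.
Proof. by exists \1%VF; [exact: weyl_id|rewrite id_lfunE]. Qed.

Lemma weyl_conjugate_sym a b : weyl_conjugate a b -> weyl_conjugate b a.
Proof.
case=> w Ww wab; exists (w^-1)%VF; first exact: weyl_inv.
by rewrite -wab lker0_lfunK // (weyl_lker0 Ww).
Qed.

Lemma weyl_conjugate_trans b a c :
  weyl_conjugate a b -> weyl_conjugate b c -> weyl_conjugate a c.
Proof.
case=> v Wv vab [w Ww wbc]; exists (w \o v)%VF; first exact: weyl_comp.
by rewrite comp_lfunE vab.
Qed.

Lemma weyl_conjugate_reflection a b :
  Rx a -> weyl_conjugate b (reflection form a b).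
Proof.
move=> Ra; exists (weyl_reflection form dotR a); first exact: weyl_gen.
exact: weyl_reflection_inj.
Qed.

Lemma weyl_conjugate_adjacent a b : Rx a -> Rx b ->
  form a (coroot form b) = -1 -> form b (coroot form a) = -1 ->
  weyl_conjugate a b.
Proof.
move=> Ra Rb ab ba; rewrite -[b](reflection_adjacent ab ba).
apply: (@weyl_conjugate_trans (reflection form b a));
  exact: weyl_conjugate_reflection.
Qed.

Hypothesis form_psd : forall x, 0 <= form x x.

Lemma nonisotropicP a : Rx a <-> R a /\ 0 < form a a.
Proof.
split=> [[Ra nra]|[Ra a0]]; split=> //; last first.
  by case=> _ /= /radicalP/(_ a) e; rewrite e ltxx in a0.
rewrite lt_def form_psd andbT; apply/eqP => a0; apply: nra; split=> //=.
by apply/radicalP; apply: psd_isotropic.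
Qed.

Hypothesis ears : extended_affine_root_system form R.

Lemma reflection_root a b : Rx a -> Rx b -> Rx (reflection form a b).
Proof.
move=> Ra /nonisotropicP[Rb b0]; apply/nonisotropicP.
by split; [exact: ears_reflection|rewrite reflection_isometry].
Qed.

Lemma quot_coroot x y :
  quot_form (quot_map form x) (coroot (@quot_form K V form) (quot_map form y)) =
  form x (coroot form y).
Proof. by rewrite !form_coroot /= !quot_form_map. Qed.

Section SimpleRoots.
Variables (l : nat) (X : l.-tuple (subvs_of (radical form)^C%VS)).
Hypothesis baseX : root_base (quot_image (form:=form) R) X.
Hypothesis X2 : forall i : 'I_l,
  quot_form X`_i (coroot (@quot_form K V form) X`_i) = 2.
Hypothesis adjX : forall i : 'I_l, exists j : 'I_l,
  quot_form X`_j (coroot (@quot_form K V form) X`_i) = -1.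

Definition simple_lift (i : 'I_l) y := R y /\ quot_map form y = X`_i.

Lemma simple_lift_ex i : exists y, simple_lift i y.
Proof. by case: baseX => _ /(_ i)[y Ry e] _; exists y. Qed.

Lemma simple_lift_root i y : simple_lift i y -> Rx y.
Proof.
case=> Ry e; apply/nonisotropicP; split=> //.
rewrite lt_def form_psd andbT; apply/eqP => y0.
have := X2 i; rewrite -e quot_coroot form_coroot y0 mulr0 => /eqP.
by rewrite eq_sym pnatr_eq0.
Qed.

Lemma coord_combination (c : 'I_l -> nat) i :
  coord X i (\sum_(j < l) X`_j *+ c j) = (c i)%:R.
Proof.
case: baseX => /basis_free Xfree _ _.
under eq_bigr => j _ do rewrite -scaler_nat.
by rewrite coord_sum_free.
Qed.

(** Induction on the height of the combination.  As the root has positive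
    norm, it pairs positively with some simple root X_i of its support.  If
    the support contains another node j, reflecting in a lift of X_i keeps the
    coefficient at j, so the result is again a natural combination, of smaller
    height.  Otherwise the root is c X_i modulo the radical, and its integral
    pairing with a neighbour of X_i forces c = 1. *)
Lemma simple_lift_combination (c : 'I_l -> nat) a :
  Rx a -> quot_map form a = \sum_(i < l) X`_i *+ c i ->
  exists i y, simple_lift i y /\ weyl_conjugate a y.
Proof.
have [n] := ubnP (\sum_(i < l) c i)%N.
elim: n c a => // n IHn c a; rewrite ltnS => len Ra qa.
have [_ a0] := (nonisotropicP a).1 Ra.
have [i ci0 ai0] : exists2 i : 'I_l, (0 < c i)%N &
    0 < quot_form X`_i (quot_map form a).
  apply: contrapT => none.
  suff : form a a <= 0 by rewrite leNgt a0.
  rewrite -quot_form_map {1}qa.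
  have -> : quot_form (\sum_(i < l) X`_i *+ c i) (quot_map form a) =
      \sum_(i < l) quot_form X`_i (quot_map form a) *+ c i.
    by rewrite linear_sumlz; apply: eq_bigr => i _; rewrite linearMnl.
  apply: sumr_le0 => i _; have [->|ci0] := posnP (c i); first by rewrite mulr0n.
  apply: mulrn_wle0; rewrite leNgt; apply/negP => ai0.
  by apply: none; exists i.
have [x xi] := simple_lift_ex i.
have Rxx := simple_lift_root xi.
have [_ x0] := (nonisotropicP x).1 Rxx.
case: xi => Rx0 qx.
have [[j cj0 ji]|single] := pselect (exists2 j, (0 < c j)%N & j != i).
  pose m := form a (coroot form x).
  have m0 : 0 < m.
    by rewrite /m form_coroot mulr_gt0 ?divr_gt0 // formC -quot_form_map qx.
  pose b := reflection form x a.
  have Rb : Rx b by apply: reflection_root.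
  have qb : quot_map form b = quot_map form a - m *: X`_i.
    by rewrite /b /reflection linearB linearZ /= qx.
  have [_ _ /(_ (quot_map form b))[|d qd]] := baseX.
    by exists b => //; case: Rb.
  have cqb k : coord X k (quot_map form b) = (c k)%:R - m * (k == i)%:R.
    rewrite qb linearB linearZ /= qa coord_combination.
    by case: baseX => /basis_free Xfree _ _; rewrite coord_free // eq_sym.
  (* The coefficient at j is untouched, so it decides the sign. *)
  have {}qd : quot_map form b = \sum_(k < l) X`_k *+ d k.
    case: qd => // qd; have := cqb j.
    rewrite qd linearN /= coord_combination (negPf ji) mulr0 subr0 => e.
    have : (0 : K) < (c j)%:R by rewrite ltr0n.
    by rewrite -e oppr_gt0 ltrn0.
  have dE k : (d k)%:R = (c k)%:R - m * (k == i)%:R.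
    by rewrite -cqb qd coord_combination.
  have [|k [y [yk by_]]] := IHn d b _ Rb qd.
    apply: leq_trans len.
    rewrite (bigD1 i) //= [X in (_ < X)%N](bigD1 i) //= -addSn leq_add //.
      by rewrite -(ltr_nat K) dE eqxx mulr1 gtrBl.
    apply: leq_sum => k ki; rewrite -(ler_nat K) dE (negPf ki) mulr0 subr0.
    exact: lexx.
  exists k, y; split=> //; apply: weyl_conjugate_trans by_.
  exact: weyl_conjugate_reflection.
have {}qa : quot_map form a = X`_i *+ c i.
  rewrite qa (bigD1 i) //= big1 ?addr0 // => j ji.
  have [->|cj0] := posnP (c j); first by rewrite mulr0n.
  by case: single; exists j.
have [j adj] := adjX i; have [z zj] := simple_lift_ex j.
have Rz := simple_lift_root zj.
have /intrP[u hu] := ears_int ears Ra Rz.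
have ciK : (c i)%:R != 0 :> K by rewrite pnatr_eq0 -lt0n.
have Xi0 : quot_form X`_i X`_i != 0 by rewrite -qx quot_form_map gt_eqF.
(* The coroot of c X_i is the coroot of X_i divided by c. *)
have uc : u%:~R * (c i)%:R = -1 :> K.
  rewrite -hu -adj -quot_coroot !form_coroot /= qa -scaler_nat zj.2.
  rewrite !linearZl_LR /= !linearZr /=.
  move: Xi0 ciK; move: (quot_form _ _) (quot_form _ _) (c i)%:R => p q k p0 k0.
  by field; rewrite p0 k0.
have ci1 : c i = 1%N.
  have : u * (c i)%:Z = -1 by apply: (@intr_inj K); rewrite intrM.
  move=> /(congr1 absz); rewrite abszM absz_nat => /eqP.
  by rewrite muln_eq1 => /andP[_ /eqP].
exists i, a; split; last exact: weyl_conjugate_refl.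
by split; [case: Ra|rewrite qa ci1].
Qed.

Lemma simple_lift_conjugate (i j : 'I_l) y z :
  quot_form X`_i (coroot (@quot_form K V form) X`_j) = -1 ->
  quot_form X`_j (coroot (@quot_form K V form) X`_i) = -1 ->
  simple_lift i y -> simple_lift j z -> weyl_conjugate y z.
Proof.
move=> ij ji yi zj; apply: weyl_conjugate_adjacent.
- exact: simple_lift_root yi.
- exact: simple_lift_root zj.
- by rewrite -quot_coroot yi.2 zj.2.
- by rewrite -quot_coroot yi.2 zj.2.
Qed.

Lemma root_simple_lift a :
  Rx a -> exists i y, simple_lift i y /\ weyl_conjugate a y.
Proof.
move=> Ra; case: (baseX) => _ _ /(_ (quot_map form a))[|c [qa|qa]].
- by exists a => //; case: Ra.
- exact: simple_lift_combination qa.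
have [_ a0] := (nonisotropicP a).1 Ra.
have aN : reflection form a a = - a by rewrite reflection_self // gt_eqF.
have [||i [y [yi ay]]] := @simple_lift_combination c (- a).
- by rewrite -aN; apply: reflection_root.
- by rewrite linearN /= qa opprK.
exists i, y; split=> //; apply: weyl_conjugate_trans ay.
by rewrite -aN; apply: weyl_conjugate_reflection.
Qed.

End SimpleRoots.

(** Each root is conjugate to a lift of some simple root, and this lift is
    moved along the diagram to one fixed lift x of the first simple root. *)
Lemma weyl_transitive a b :
  simply_laced_rank_gt1 form R -> Rx a -> Rx b -> weyl_conjugate a b.
Proof.
case=> t rk [X baseX cartanX] Ra Rb.
have [l1 e01] := dynkin_edge01 rk.
have edge (i j : 'I_(type_rank t)) : (i < j)%N -> dynkin_edge t i j ->
    quot_form X`_i (coroot (@quot_form K V form) X`_j) = -1 /\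
    quot_form X`_j (coroot (@quot_form K V form) X`_i) = -1.
  by move=> ij /(cartan_edge ij)[cij cji]; rewrite !cartanX cij cji.
have X2 (i : 'I_(type_rank t)) :
    quot_form X`_i (coroot (@quot_form K V form) X`_i) = 2.
  by rewrite cartanX /cartan eqxx.
have adjX (i : 'I_(type_rank t)) : exists j : 'I_(type_rank t),
    quot_form X`_j (coroot (@quot_form K V form) X`_i) = -1.
  have [i0|i0] := posnP i.
    by exists (Ordinal l1); apply: (edge i (Ordinal l1) _ _).2; rewrite i0.
  have [j ji e] : exists2 j, (j < i)%N & dynkin_edge t j i.
    by apply: dynkin_edge_left => //; rewrite i0 ltn_ord.
  exists (Ordinal (ltn_trans ji (ltn_ord i))).
  exact: (edge (Ordinal (ltn_trans ji (ltn_ord i))) i _ _).1.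
pose o : 'I_(type_rank t) := Ordinal (ltnW l1).
have to0 x : simple_lift X o x -> forall n (i : 'I_(type_rank t)) y,
    nat_of_ord i = n -> simple_lift X i y -> weyl_conjugate y x.
  move=> xo; elim/ltn_ind => n IHn i y iE yi; have [n0|n0] := posnP n.
    (* Two lifts of the first simple root, which may differ by an isotropic
       vector, meet at a lift of the second. *)
    have [z z1] := simple_lift_ex baseX (Ordinal l1).
    have [c01 c10] := edge o (Ordinal l1) isT e01.
    have io : i = o by apply: val_inj; rewrite /= iE n0.
    apply: (@weyl_conjugate_trans z).
      by apply: (simple_lift_conjugate X2 c01 c10) z1; rewrite -io.
    exact: (simple_lift_conjugate X2 c10 c01).
  have [j ji e] : exists2 j, (j < i)%N & dynkin_edge t j i.
    by apply: dynkin_edge_left => //; rewrite iE n0 -iE ltn_ord.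
  pose j' := Ordinal (ltn_trans ji (ltn_ord i)).
  have [cji cij] := edge j' i ji e.
  have [z zj] := simple_lift_ex baseX j'.
  apply: (@weyl_conjugate_trans z).
    exact: (simple_lift_conjugate X2 cij cji).
  by apply: (IHn j _ j') zj; rewrite // -iE.
have [x xo] := simple_lift_ex baseX o.
have conj_x c : Rx c -> weyl_conjugate c x.
  move=> /(root_simple_lift baseX X2 adjX)[i [y [yi cy]]].
  by apply: weyl_conjugate_trans cy _; apply: (to0 x xo i).
apply: (weyl_conjugate_trans (conj_x a Ra)).
exact/weyl_conjugate_sym/conj_x.
Qed.

(** * Reflectable sets generate the Weyl group *)

(** W_P contains the reflection in every member of W_P P. *)
Lemma reflectable_weyl P : P `<=` Rx -> reflectable form dotR R P ->
  weyl dotR P = weyl dotR Rx :> set 'End(ext_space form).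
Proof.
move=> PR refl; apply/seteqP; split.
  by apply: weyl_sub => [|a /PR]; [exact: weyl_GL_subgroup|exact: weyl_gen].
apply: weyl_sub => [|b Rb]; first exact: weyl_GL_subgroup.
have : @weyl_orbit K V form dotR P (iota b) by rewrite refl; exists b.
by case=> f Wf [a Pa fab]; apply: weyl_reflection_conj Wf Pa fab.
Qed.

(** The empty set generates the trivial group, whereas the reflection in a root
    changes its sign. *)
Lemma generators_nonempty P :
  weyl dotR P = weyl dotR Rx :> set 'End(ext_space form) -> P !=set0.
Proof.
move=> WP; apply/set0P/eqP => P0; have [a Ra] := ears_nonempty ears.
have [_ a0] := (nonisotropicP a).1 Ra.
have /weyl0/lfunP/(_ (iota a)) : weyl dotR set0 (weyl_reflection form dotR a).
  by rewrite -P0 WP; apply: weyl_gen.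
rewrite weyl_reflection_inj id_lfunE reflection_self ?gt_eqF //.
move=> /ext_inj_is_inj aN.
by have := a0; rewrite -{1}aN linearNl /= oppr_gt0 ltNge ltW.
Qed.

(** By transitivity the W-orbit of a single element of Q is the set of all
    roots; the inclusion of Q in P bounds W_Q Q by W_P P. *)
Lemma weyl_reflectable Q P : simply_laced_rank_gt1 form R ->
  reflectable form dotR R P -> Q `<=` P -> P `<=` Rx ->
  weyl dotR Q = weyl dotR Rx :> set 'End(ext_space form) ->
  reflectable form dotR R Q.
Proof.
move=> sl reflP QP PR WQ; apply/seteqP; split.
  rewrite -reflP /weyl_orbit WQ (reflectable_weyl PR reflP).
  by move=> _ [f Wf [a Qa <-]]; exists f => //; exists a => //; apply: QP.
move=> _ [b Rb <-]; have [a Qa] := generators_nonempty WQ.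
have [w Ww wab] := weyl_transitive sl (PR _ (QP _ Qa)) Rb.
by exists w; [rewrite WQ|exists a].
Qed.

End Orbits.

Theorem proposition4p4p2 (K : realType) (V : vectType K)
    (form : {symmetric V}) (form_psd : forall x, 0 <= form x x)
    (R : set V) (ears : extended_affine_root_system form R)
    (simply_laced : simply_laced_rank_gt1 form R)
    (dotR : seq V) (lift : finite_lift form R dotR) :
  reflectable_bases form dotR R = minimal_reflectable_bases form dotR R.
Proof.
apply/seteqP; split=> [P|P [//]]; move=> basisP; split=> //.
case: basisP => PR reflP minP; split=> // [|Q QP WQ].
  exact: reflectable_weyl.
by apply: (minP Q QP); apply: (weyl_reflectable _ _ _ reflP) => //; case: QP.
Qed.
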